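(* Let $i\neq j$ be two rectangular objects with parameters $\mathrm{LB}_{ks},\mathrm{UB}_{ks},\mathrm{P}_{kls}$ ($(k,l,s)\in\mathscr{F}_{ij}$) as described in the context. If $\mathrm{P}_{kls}<\mathrm{UB}_{ls}-\mathrm{LB}_{ks}$ for each $(k,l,s)\in\mathscr{F}_{ij}$, then the Simple Binary Multilinear formulation (SB-M) is pairwise-ideal; that is, every extreme point $(\mathbf{c},\Delta_{ij},\delta_{ij},\delta_{ji})\in\mathbb{R}^4\times\mathbb{R}\times\mathbb{R}^2$ of the continuous relaxation of (SB-M) for the pair $(i,j)$ satisfies $(\delta_{ij},\delta_{ji})\in\{0,1\}^2$.
   Context: Parameters. The region has dimensions $W_x\times W_y$. Each object $k\in\{i,j\}$ has dimensions $w_{ks}>0$ and clearances $\sigma^-_{ks},\sigma^+_{ks}\ge 0$ for $s\in\{x,y\}$. Put $\mathscr{F}_{ij}=\{(i,j,x),(j,i,x),(i,j,y),(j,i,y)\}$, $\mathrm{LB}_{ks}=\tfrac12 w_{ks}+\sigma^-_{ks}$ and $\mathrm{UB}_{ks}=W_s-\tfrac12 w_{ks}-\sigma^+_{ks}$. The precedence margins $\mathrm{P}_{kls}$, $(k,l,s)\in\mathscr{F}_{ij}$, are reals with $\mathrm{P}_{kls}\ge\tfrac12 w_{ks}+\tfrac12 w_{ls}+\max\{\sigma^+_{ks},\sigma^-_{ls}\}$ (equality in the basic model; larger margins are allowed). Formulation (SB-M) for the pair $(i,j)$. Continuous variables $c_{ix},c_{jx},c_{iy},c_{jy},\Delta_{ij}$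 and binary variables $\delta_{ij},\delta_{ji}$. Define the affine functions $$H_{ijx}=\delta_{ij}+\delta_{ji}-\Delta_{ij},\quad H_{ijy}=1-\delta_{ij}+\Delta_{ij},\quad H_{jix}=1-\Delta_{ij},\quad H_{jiy}=1-\delta_{ji}+\Delta_{ij}.$$ The constraints are, for all $(k,l,s)\in\mathscr{F}_{ij}$: $$c_{ls}\ge \mathrm{LB}_{ks}+\mathrm{P}_{kls}-(\mathrm{LB}_{ks}+\mathrm{P}_{kls}-\mathrm{LB}_{ls})H_{kls},$$ $$c_{ks}\le \mathrm{UB}_{ls}-\mathrm{P}_{kls}-(\mathrm{UB}_{ls}-\mathrm{P}_{kls}-\mathrm{UB}_{ks})H_{kls},$$ $$c_{ls}-c_{ks}\ge \mathrm{P}_{kls}+(\mathrm{LB}_{ls}-\mathrm{P}_{kls}-\mathrm{UB}_{ks})H_{kls},$$ together with $\delta_{ij}+\delta_{ji}-\Delta_{ij}\le1$, $\delta_{ij}-\Delta_{ij}\ge0$, $\delta_{ji}-\Delta_{ij}\ge0$, $\Delta_{ij}\ge0$, and $(\delta_{ij},\delta_{ji})\in\{0,1\}^2$. The continuous relaxation replaces $(\delta_{ij},\delta_{ji})\in\{0,1\}^2$ by $(\delta_{ij},\delta_{ji})\in[0,1]^2$. A mixed-integer program is ideal if every extreme point of its continuous relaxation takes integer values in all integer variables; a packing formulation is pairwise-ideal if it is ideal when restricted to two objects. *)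

(* Defs.v *)
From mathcomp Require Import all_boot all_order all_algebra.
From mathcomp Require Import reals.

Set Implicit Arguments.
Unset Strict Implicit.
Unset Printing Implicit Defensive.

Import Order.TTheory GRing.Theory Num.Theory.
Local Open Scope ring_scope.

Definition extreme_point (R : realType) (V : lmodType R)
    (A : V -> Prop) (z : V) : Prop :=
  A z /\ forall (u v : V) (t : R), A u -> A v -> 0 < t < 1 ->
    z = t *: u + (1 - t) *: v -> u = v.

(* A mixed-binary program over V (feasible region only): its points are the z
   satisfying [constraints] such that all entries of [binaries z] are in {0,1};
   the remaining variables are continuous. *)
Record mbp (R : realType) (V : lmodType R) := Mbp {
  num_binaries : nat;
  constraints : V -> Prop;
  binaries : V -> 'rV[R]_num_binaries
}.

Definition relaxation (R : realType) (V : lmodType R) (M : mbp V) (z : V) :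
    Prop :=
  constraints M z /\ forall b, 0 <= binaries M z 0 b <= 1.

Definition ideal (R : realType) (V : lmodType R) (M : mbp V) : Prop :=
  forall z, extreme_point (relaxation M) z ->
    forall b, binaries M z 0 b \is a Num.int.

(* Objects i, j are encoded as 0, 1; so are the axes x, y. *)
Notation object := 'I_2 (only parsing).
Notation axis := 'I_2 (only parsing).
Notation obj_i := (@Ordinal 2 0 isT).
Notation obj_j := (@Ordinal 2 1 isT).
Notation axis_x := (@Ordinal 2 0 isT) (only parsing).
Notation axis_y := (@Ordinal 2 1 isT) (only parsing).

Definition F_ij : seq (object * object * axis) :=
  [:: (obj_i, obj_j, axis_x); (obj_j, obj_i, axis_x);
      (obj_i, obj_j, axis_y); (obj_j, obj_i, axis_y)].

Section Data.
Variable R : realType.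

Definition LB (w sm : object -> axis -> R) (k : object) (s : axis) : R :=
  w k s / 2 + sm k s.

Definition UB (W : axis -> R) (w sp : object -> axis -> R)
    (k : object) (s : axis) : R :=
  W s - w k s / 2 - sp k s.

(* Points (c, Delta_ij, (delta_ij, delta_ji)) of R^4 x R x R^2. *)
Definition point : lmodType R := ('M[R]_2 * R^o * 'rV[R]_2)%type.

Definition ctr (z : point) (k : object) (s : axis) : R := z.1.1 k s.
Definition Delta_ij (z : point) : R := z.1.2.
Definition delta_ij (z : point) : R := z.2 0 obj_i.
Definition delta_ji (z : point) : R := z.2 0 obj_j.

(* The affine function H_{kls}; only its values for k != l are used, so that l
   is determined by k. *)
Definition H (z : point) (k l : object) (s : axis) : R :=
  if s == axis_x then
    if k == obj_i then delta_ij z + delta_ji z - Delta_ij z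
    else 1 - Delta_ij z
  else
    if k == obj_i then 1 - delta_ij z + Delta_ij z
    else 1 - delta_ji z + Delta_ij z.

Definition SBM_constraints (lb ub : object -> axis -> R)
    (P : object -> object -> axis -> R) (z : point) : Prop :=
  (forall (k l : object) (s : axis), (k, l, s) \in F_ij ->
    [/\ ctr z l s >= lb k s + P k l s
                     - (lb k s + P k l s - lb l s) * H z k l s,
        ctr z k s <= ub l s - P k l s
                     - (ub l s - P k l s - ub k s) * H z k l s
      & ctr z l s - ctr z k s >= P k l s
                     + (lb l s - P k l s - ub k s) * H z k l s]) /\
  [/\ delta_ij z + delta_ji z - Delta_ij z <= 1,
      delta_ij z - Delta_ij z >= 0,
      delta_ji z - Delta_ij z >= 0
    & Delta_ij z >= 0].

Definition SBM (W : axis -> R) (w sm sp : object -> axis -> R)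
    (P : object -> object -> axis -> R) : mbp point :=
  {| num_binaries := 2;
     constraints := SBM_constraints (LB w sm) (UB W w sp) P;
     binaries := fun z : point => z.2 |}.

End Data.

(* Main.v *)
Require Import Defs.
From mathcomp Require Import all_boot all_order all_algebra.
From mathcomp Require Import reals.
From mathcomp Require Import ring lra.

Set Implicit Arguments.
Unset Strict Implicit.
Unset Printing Implicit Defensive.

Import Order.TTheory GRing.Theory Num.Theory.
Local Open Scope ring_scope.

(** The constraints on the binaries describe a simplex whose barycentric
    coordinates are the four weights 1 - H_{kls}. On each axis, the centres
    allowed by weights a (for k before l), b (for l before k) and r (for no
    precedence) form the Minkowski sum a T + b T' + r B, where T and T' are the
    triangles of ordered placements and B is the box of all placements: in the
    plane it suffices to compare support functions along the six edge normals.
    Hence a feasible point with fractional delta splits into feasible points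
    with delta = 1 and delta = 0, so it is not extreme. *)

(** * Splitting placements along one axis *)

Section AxisCone.
Variable R : realFieldType.
Implicit Types (l u p x y a b n : R).

(* The three constraints attached to one (k, l, s), homogenized: n is the total
   weight and a = n - H_{kls} is the weight of "k precedes l". *)
Definition prec_cone l1 u1 l2 u2 p n a x y : Prop :=
  [/\ n * l2 + a * (l1 + p - l2) <= y,
      x <= n * u1 + a * (u2 - p - u1)
    & n * (l2 - u1) + a * (p + u1 - l2) <= y - x].

Definition axis_cone l1 u1 l2 u2 p12 p21 n a b x y : Prop :=
  prec_cone l1 u1 l2 u2 p12 n a x y /\ prec_cone l2 u2 l1 u1 p21 n b y x.

Lemma prec_coneZ l1 u1 l2 u2 p n a x y e : 0 <= e ->
  prec_cone l1 u1 l2 u2 p n a x y ->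
  prec_cone l1 u1 l2 u2 p (e * n) (e * a) (e * x) (e * y).
Proof.
move=> e0 [h1 h2 h3]; split.
- by rewrite -!mulrA -mulrDr ler_wpM2l.
- by rewrite -!mulrA -mulrDr ler_wpM2l.
- by rewrite -!mulrA -mulrDr -mulrBr ler_wpM2l.
Qed.

(** Each part keeps a single direction of precedence, so their demands agree: the first wants [x1]
    small and [y1] large, the second wants [x - x1] large and [y - y1] small. Only the box bounds of
    the two parts limit this common shift. *)
Lemma axis_cone_split l1 u1 l2 u2 p12 p21 a b r1 r2 x y :
  l1 <= u1 -> l2 <= u2 -> l1 + p12 <= u2 -> l2 + p21 <= u1 ->
  0 <= a -> 0 <= b -> 0 <= r1 -> 0 <= r2 ->
  axis_cone l1 u1 l2 u2 p12 p21 (a + r1 + (b + r2)) a b x y ->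
  exists x1 y1, axis_cone l1 u1 l2 u2 p12 p21 (a + r1) a 0 x1 y1 /\
    axis_cone l1 u1 l2 u2 p12 p21 (b + r2) 0 b (x - x1) (y - y1).
Proof.
rewrite -![_ + _ <= _]subr_ge0 -(subr_ge0 l1) -(subr_ge0 l2).
move=> lu1 lu2 lu12 lu21 a0 b0 r10 r20 [[h1 h2 h3] [h4 h5 h6]].
(* These products of weights and slacks are all the nonlinear facts needed; the rest is linear in
   the monomials. *)
have t1 := mulr_ge0 a0 lu12; have t2 := mulr_ge0 b0 lu21.
have s1 := mulr_ge0 r10 lu1; have s2 := mulr_ge0 r10 lu2.
have s3 := mulr_ge0 r20 lu1; have s4 := mulr_ge0 r20 lu2.
(* Greedy: the second part takes the centre of object 1 as far up, and that of
   object 2 as far down, as its own bounds permit. *)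
pose xa := (a + r1) * l1; pose xb := x - (b + r2) * u1.
pose ya := (a + r1) * u2; pose yb := y - (b + r2) * l2.
exists (Num.max xa xb), (Num.min ya yb); rewrite /axis_cone /prec_cone.
by case: (leP xa xb) => hx; case: (leP ya yb) => hy;
   rewrite /xa /xb /ya /yb in hx hy *; split; split; split; lra.
Qed.

End AxisCone.

(** * The cone over the relaxation and its splitting by a binary *)

Section Homogenization.
Variable R : realType.
Variables (lb ub : object -> axis -> R) (P : object -> object -> axis -> R).
Implicit Types z q : point R.

Definition axis_feasible (s : axis) (n a b x y : R) : Prop :=
  axis_cone (lb obj_i s) (ub obj_i s) (lb obj_j s) (ub obj_j s)
    (P obj_i obj_j s) (P obj_j obj_i s) n a b x y.

(** The constant 1 of each [H] becomes [n], so the precedence weights passed to [axis_feasible] are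
    the differences [n - H]. *)
Definition SBM_cone (n : R) z : Prop :=
  [/\ axis_feasible axis_x n (n - (delta_ij z + delta_ji z - Delta_ij z))
        (Delta_ij z) (ctr z obj_i axis_x) (ctr z obj_j axis_x),
      axis_feasible axis_y n (delta_ij z - Delta_ij z)
        (delta_ji z - Delta_ij z) (ctr z obj_i axis_y) (ctr z obj_j axis_y)
    & [/\ delta_ij z + delta_ji z - Delta_ij z <= n,
          0 <= delta_ij z - Delta_ij z, 0 <= delta_ji z - Delta_ij z
        & 0 <= Delta_ij z]].

Lemma SBM_coneZ (e n : R) z :
  0 <= e -> SBM_cone n z -> SBM_cone (e * n) (e *: z).
Proof.
move=> e0 [[hx1 hx2] [hy1 hy2] [d1 d2 d3 d4]].
rewrite /SBM_cone /delta_ij /delta_ji /Delta_ij /ctr /= !mxE.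
rewrite -[e *: _]/(e * z.1.2) -!mulrDr -!mulrBr.
split; first by split; apply: prec_coneZ.
  by split; apply: prec_coneZ.
by split; rewrite ?mulr_ge0 // ler_wpM2l.
Qed.

Lemma SBM_cone1 z : SBM_cone 1 z <-> SBM_constraints lb ub P z.
Proof.
rewrite /SBM_cone /axis_feasible /axis_cone /prec_cone; split.
  move=> [[[a1 a2 a3] [a4 a5 a6]] [[b1 b2 b3] [b4 b5 b6]] d]; split=> // k l s.
  by rewrite !inE => /or4P[] /eqP[-> -> ->]; rewrite /H /=; split; lra.
move=> [h d].
have /h := mem_head _ _ : (obj_i, obj_j, axis_x) \in F_ij.
have /h : (obj_j, obj_i, axis_x) \in F_ij by [].
have /h : (obj_i, obj_j, axis_y) \in F_ij by [].
have /h : (obj_j, obj_i, axis_y) \in F_ij by [].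
rewrite /H /= => -[? ? ?] [? ? ?] [? ? ?] [? ? ?].
by split=> //; split; split; lra.
Qed.

Definition mk_point (xi xj yi yj D di dj : R) : point R :=
  (\matrix_(k, s) (if s == axis_x then if k == obj_i then xi else xj
                   else if k == obj_i then yi else yj),
   D : R^o, \row_b if b == obj_i then di else dj).

Lemma mk_pointE (xi xj yi yj D di dj : R) :
  let z := mk_point xi xj yi yj D di dj in
  ((ctr z obj_i axis_x = xi) * (ctr z obj_j axis_x = xj) *
   (ctr z obj_i axis_y = yi) * (ctr z obj_j axis_y = yj) *
   (Delta_ij z = D) * (delta_ij z = di) * (delta_ji z = dj))%type.
Proof. by rewrite /ctr /Delta_ij /delta_ij /delta_ji /= !mxE. Qed.

Lemma pointB z q :
  ((forall k s, ctr (z - q) k s = ctr z k s - ctr q k s) *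
   (Delta_ij (z - q) = Delta_ij z - Delta_ij q) *
   (delta_ij (z - q) = delta_ij z - delta_ij q) *
   (delta_ji (z - q) = delta_ji z - delta_ji q))%type.
Proof.
by split; [split; [split => [k s|]|]|];
   rewrite /ctr /Delta_ij /delta_ij /delta_ji /= ?mxE.
Qed.

Hypothesis lb_le_ub : forall k s, lb k s <= ub k s.
Hypothesis lbP_le_ub :
  forall k l s, (k, l, s) \in F_ij -> lb k s + P k l s <= ub l s.

Lemma axis_feasible_split s (a b r1 r2 x y : R) :
  0 <= a -> 0 <= b -> 0 <= r1 -> 0 <= r2 ->
  axis_feasible s (a + r1 + (b + r2)) a b x y ->
  exists x1 y1, axis_feasible s (a + r1) a 0 x1 y1 /\
    axis_feasible s (b + r2) 0 b (x - x1) (y - y1).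
Proof.
apply: axis_cone_split; rewrite ?lb_le_ub // lbP_le_ub //;
  by case: s => -[|[]].
Qed.

(** [q] gathers the vertices with [delta_ij] equal to 1, of total weight [a10 + a11]. On x the
    opposite precedences have weights [a00] and [a11], on y [a10] and [a01], so each half contains
    one direction per axis. *)
Lemma SBM_cone_split_ij z :
  SBM_cone 1 z -> exists2 q, delta_ij q = delta_ij z &
    SBM_cone (delta_ij z) q /\ SBM_cone (1 - delta_ij z) (z - q).
Proof.
move=> [hx hy [d1 d2 d3 d4]].
(* a_de is the barycentric weight of the vertex delta_ij = d, delta_ji = e. *)
pose a00 := 1 - (delta_ij z + delta_ji z - Delta_ij z).
pose a10 := delta_ij z - Delta_ij z; pose a01 := delta_ji z - Delta_ij z.
pose a11 := Delta_ij z.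
have a00_ge0 : 0 <= a00 by rewrite subr_ge0.
have [] := @axis_feasible_split axis_x a00 a11 a01 a10
             (ctr z obj_i axis_x) (ctr z obj_j axis_x) => //.
  by move: hx; congr axis_feasible; rewrite /a00 /a01 /a10 /a11; ring.
move=> xi [xj [hx1 hx2]].
have [] := @axis_feasible_split axis_y a10 a01 a11 a00
             (ctr z obj_i axis_y) (ctr z obj_j axis_y) => //.
  by move: hy; congr axis_feasible; rewrite /a00 /a01 /a10 /a11; ring.
move=> yi [yj [hy1 hy2]].
(* The half of [q] is the second part on x (it contains [a11]) and the first on y (it contains
   [a10]); its [delta_ji] is the weight [a11]. *)
exists (mk_point (ctr z obj_i axis_x - xi) (ctr z obj_j axis_x - xj) yi yj
          (Delta_ij z) (delta_ij z) (Delta_ij z)).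
  by rewrite mk_pointE.
split; split; rewrite !(pointB, mk_pointE) ?subKr.
- by move: hx2; congr axis_feasible; rewrite /a00 /a01 /a10 /a11; ring.
- by move: hy1; congr axis_feasible; rewrite /a00 /a01 /a10 /a11; ring.
- by split; lra.
- by move: hx1; congr axis_feasible; rewrite /a00 /a01 /a10 /a11; ring.
- by move: hy2; congr axis_feasible; rewrite /a00 /a01 /a10 /a11; ring.
- by split; lra.
Qed.

(** Here [q] gathers [a01] and [a11], the weights of j before i on y and on x, so it is the second
    part on both axes. *)
Lemma SBM_cone_split_ji z :
  SBM_cone 1 z -> exists2 q, delta_ji q = delta_ji z &
    SBM_cone (delta_ji z) q /\ SBM_cone (1 - delta_ji z) (z - q).
Proof.
move=> [hx hy [d1 d2 d3 d4]].
pose a00 := 1 - (delta_ij z + delta_ji z - Delta_ij z).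
pose a10 := delta_ij z - Delta_ij z; pose a01 := delta_ji z - Delta_ij z.
pose a11 := Delta_ij z.
have a00_ge0 : 0 <= a00 by rewrite subr_ge0.
have [] := @axis_feasible_split axis_x a00 a11 a10 a01
             (ctr z obj_i axis_x) (ctr z obj_j axis_x) => //.
  by move: hx; congr axis_feasible; rewrite /a00 /a01 /a10 /a11; ring.
move=> xi [xj [hx1 hx2]].
have [] := @axis_feasible_split axis_y a10 a01 a00 a11
             (ctr z obj_i axis_y) (ctr z obj_j axis_y) => //.
  by move: hy; congr axis_feasible; rewrite /a00 /a01 /a10 /a11; ring.
move=> yi [yj [hy1 hy2]].
exists (mk_point (ctr z obj_i axis_x - xi) (ctr z obj_j axis_x - xj)
          (ctr z obj_i axis_y - yi) (ctr z obj_j axis_y - yj)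
          (Delta_ij z) (Delta_ij z) (delta_ji z)).
  by rewrite mk_pointE.
split; split; rewrite !(pointB, mk_pointE) ?subKr.
- by move: hx2; congr axis_feasible; rewrite /a00 /a01 /a10 /a11; ring.
- by move: hy2; congr axis_feasible; rewrite /a00 /a01 /a10 /a11; ring.
- by split; lra.
- by move: hx1; congr axis_feasible; rewrite /a00 /a01 /a10 /a11; ring.
- by move: hy1; congr axis_feasible; rewrite /a00 /a01 /a10 /a11; ring.
- by split; lra.
Qed.

End Homogenization.

(** * From splittings to extreme points *)

Section Extreme.
Variables (R : realType) (W : axis -> R) (w sm sp : object -> axis -> R).
Variable P : object -> object -> axis -> R.

Let cone := SBM_cone (LB w sm) (UB W w sp) P.

(** The simplex inequalities already force both binaries into [0,1]. *)
Lemma cone1_relaxation z : cone 1 z -> relaxation (SBM W w sm sp P) z.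
Proof.
move=> cz; split; first exact/SBM_cone1.
move: cz => [_ _]; rewrite /delta_ij /delta_ji => -[? ? ? ?].
by case=> -[|[]] //= lt_b; rewrite (bool_irrelevance lt_b isT); lra.
Qed.

(** Rescaled to total weight 1, the two parts are feasible and have [z] as a convex combination, so
    both equal [z]. *)
Lemma extreme_cone_split (z q : point R) t :
  extreme_point (relaxation (SBM W w sm sp P)) z -> 0 < t < 1 ->
  cone t q -> cone (1 - t) (z - q) -> q = t *: z.
Proof.
move=> [_ ext] /andP[t_gt0 t_lt1] cq czq.
have t_neq0 := lt0r_neq0 t_gt0.
have t'_gt0 : 0 < 1 - t by rewrite subr_gt0.
have t'_neq0 := lt0r_neq0 t'_gt0.
pose u : point R := t^-1 *: q; pose v : point R := (1 - t)^-1 *: (z - q).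
have fu : relaxation (SBM W w sm sp P) u.
  apply: cone1_relaxation; rewrite /cone -(mulVf t_neq0).
  by apply: SBM_coneZ => //; rewrite invr_ge0 ltW.
have fv : relaxation (SBM W w sm sp P) v.
  apply: cone1_relaxation; rewrite /cone -(mulVf t'_neq0).
  by apply: SBM_coneZ => //; rewrite invr_ge0 ltW.
have qE : q = t *: u by rewrite scalerA divff // scale1r.
have zqE : z - q = (1 - t) *: v by rewrite scalerA divff // scale1r.
have zE : z = t *: u + (1 - t) *: v by rewrite -zqE -qE addrC subrK.
have uv : u = v by apply: (ext u v t) => //; rewrite t_gt0.
by rewrite zE -uv -scalerDl addrCA subrr addr0 scale1r.
Qed.

End Extreme.

Theorem theorem4 (R : realType) (W : axis -> R)
  (w sm sp : object -> axis -> R) (P : object -> object -> axis -> R)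
  (w_gt0 : forall k s, 0 < w k s)
  (sm_ge0 : forall k s, 0 <= sm k s)
  (sp_ge0 : forall k s, 0 <= sp k s)
  (P_ge : forall k l s, (k, l, s) \in F_ij ->
     w k s / 2 + w l s / 2 + Num.max (sp k s) (sm l s) <= P k l s)
  (P_lt : forall k l s, (k, l, s) \in F_ij ->
     P k l s < UB W w sp l s - LB w sm k s) :
  ideal (SBM W w sm sp P) /\
  forall z : point R, extreme_point (relaxation (SBM W w sm sp P)) z ->
    (delta_ij z = 0 \/ delta_ij z = 1) /\ (delta_ji z = 0 \/ delta_ji z = 1).
Proof.
have lbP_le_ub k l s : (k, l, s) \in F_ij ->
    LB w sm k s + P k l s <= UB W w sp l s.
  by move=> /P_lt; lra.
(* Room for the other object [k] before [l] suffices: [P k l s] is at least [LB w sm l s], and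
   [LB w sm k s] is positive. *)
have lb_le_ub l s : LB w sm l s <= UB W w sp l s.
  have [k kls] : exists k, (k, l, s) \in F_ij.
    by case: l => -[|[]] // hl; [exists obj_j|exists obj_i]; case: s => -[|[]].
  have smP : sm l s <= Num.max (sp k s) (sm l s) by rewrite le_max lexx orbT.
  have := lbP_le_ub _ _ _ kls; have := P_ge _ _ _ kls.
  by have := sm_ge0 k s; have := w_gt0 k s; rewrite /LB; lra.
have integral z : extreme_point (relaxation (SBM W w sm sp P)) z ->
    (delta_ij z = 0 \/ delta_ij z = 1) /\ (delta_ji z = 0 \/ delta_ji z = 1).
  move=> ext; have [[/SBM_cone1 cz bnd] _] := ext.
  have /andP[ij0 ij1] := bnd obj_i; have /andP[ji0 ji1] := bnd obj_j.
  split.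
    have [|ij_neq0] := eqVneq (delta_ij z) 0; [by left|].
    have [|ij_neq1] := eqVneq (delta_ij z) 1; [by right|].
    have t01 : 0 < delta_ij z < 1 by rewrite lt0r ij_neq0 lt_neqAle ij_neq1 ij0.
    have [q qz [c1 c2]] := SBM_cone_split_ij lb_le_ub lbP_le_ub cz.
    have qE := extreme_cone_split ext t01 c1 c2.
    (* The [delta_ij] component of [qE] says that [delta_ij z] equals its own square. *)
    right; apply: (mulfI ij_neq0); rewrite mulr1 -[RHS]qz {}qE.
    by rewrite /delta_ij /= mxE.
  have [|ji_neq0] := eqVneq (delta_ji z) 0; [by left|].
  have [|ji_neq1] := eqVneq (delta_ji z) 1; [by right|].
  have t01 : 0 < delta_ji z < 1 by rewrite lt0r ji_neq0 lt_neqAle ji_neq1 ji0.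
  have [q qz [c1 c2]] := SBM_cone_split_ji lb_le_ub lbP_le_ub cz.
  have qE := extreme_cone_split ext t01 c1 c2.
  right; apply: (mulfI ji_neq0); rewrite mulr1 -[RHS]qz {}qE.
  by rewrite /delta_ji /= mxE.
split=> // z /integral[ij ji].
case=> -[|[|//]] lt_b; rewrite (bool_irrelevance lt_b isT).
  by case: ij; rewrite /delta_ij /= => ->.
by case: ji; rewrite /delta_ji /= => ->.
Qed.
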